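(* Let $x>0$ and $\nu\ge \frac12$. Then $$x\frac{I_{\nu-1}(x)}{I_\nu(x)}>\nu-\frac12\left(1+\frac{\nu^2}{\nu^2+x^2}\right)+\sqrt{x^2+\left(\frac{\nu}{\sqrt{\nu^2+x^2}}+\sqrt{\nu^2-\frac{x^4}{4(x^2+\nu^2)^2}}\right)^2}$$ and $$x\frac{K_{\nu+1}(x)}{K_\nu(x)}<\nu+\frac12\left(1+\frac{\nu^2}{\nu^2+x^2}\right)+\sqrt{x^2+\left(-\frac{\nu}{\sqrt{\nu^2+x^2}}+\sqrt{\nu^2-\frac{x^4}{4(x^2+\nu^2)^2}}\right)^2}.$$
   Context: $I_\nu(x)$ and $K_\nu(x)$ denote the modified Bessel functions of the first and second kind, of real order $\nu$ and real argument $x>0$. *)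

(* Defs.v *)
From Stdlib Require Import Reals Factorial.
From Coquelicot Require Import Coquelicot.
Open Scope R_scope.

(** Reciprocal Gamma function, by Gauss's limit
    1 / Gamma(z) = lim_n z (z+1) ... (z+n) / (n! n^z),
    which converges for every real z (with value 0 at z = 0, -1, -2, ...). *)
Definition rGamma (z : R) : R :=
  real (Lim_seq (fun n : nat =>
    prod_f_R0 (fun k => z + INR k) n / (INR (fact n) * Rpower (INR n) z))).

(** I_nu(x) = sum_k (x/2)^(2k+nu) / (k! Gamma(nu+k+1)), for x > 0;
    [Rpower] is only meaningful for a positive base. *)
Definition BesselI (nu x : R) : R :=
  Series (fun k : nat =>
    Rpower (x / 2) (2 * INR k + nu) * rGamma (nu + INR k + 1) / INR (fact k)).

(** K_nu(x) = int_0^oo exp(-x cosh t) cosh(nu t) dt, for x > 0 and every real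
    order nu (integer orders included, where Macdonald's formula
    pi/2 (I_{-nu} - I_nu) / sin(nu pi) has to be read as a limit). *)
Definition BesselK (nu x : R) : R :=
  RInt_gen (fun t => exp (- x * cosh t) * cosh (nu * t))
           (at_point 0) (Rbar_locally p_infty).

(* Main.v *)
(** Write y = x I_nu'/I_nu and z = - x K_nu'/K_nu; the two ratios are nu + y and
    nu + z, and both functions solve Riccati equations:
    x y' = x^2 + nu^2 - y^2 and x z' = z^2 - x^2 - nu^2.

    With q = nu^2/(nu^2+x^2), p = 1 - q, r = sqrt q, T = sqrt (nu^2 - p^2/4),
    W = r + T, S = sqrt (x^2 + W^2), the bound L = - (1+q)/2 + S for y satisfies
      S (x^2 + nu^2 - L^2 - x L') = D^2 + p r D + p^2 q W/(2T),   D = W - r S,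
    which is positive because W > T.  So L is a strict subsolution that agrees
    with y at x = 0, and y > L.  Changing the signs of r and S gives the
    supersolution for z; here D < 0, and when W < 0 the term D^2 >= p nu^2
    dominates.  If z reached this bound U, then v = z - U would satisfy
    x v' > v^2 from there on and blow up at a finite x, whereas K_nu > 0 is
    defined for all x > 0: no asymptotics of K_nu are needed. *)

Require Import Defs.
From Stdlib Require Import Reals Lra Lia Psatz Factorial.
From Coquelicot Require Import Coquelicot.
Open Scope R_scope.

(** * Riccati barriers *)

Lemma is_derive_continuity_pt (f : R -> R) (x l : R) :
  is_derive f x l -> continuity_pt f x.
Proof.
  intros H. apply continuity_pt_filterlim.
  apply (ex_derive_continuous f). now exists l.
Qed.

Lemma not_max_of_pos_derive (v : R -> R) (l a b : R) :
  a < b -> is_derive v a l -> 0 < l -> exists c, a <= c <= b /\ v a < v c.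
Proof.
  intros Hab Hd Hl.
  apply is_derive_Reals in Hd.
  destruct (Hd (l / 2)) as [d Hdd]; [lra|].
  pose proof (cond_pos d) as Hdp.
  set (h := Rmin (d / 2) (b - a)).
  assert (H1 : h <= d / 2) by apply Rmin_l.
  assert (H2 : h <= b - a) by apply Rmin_r.
  assert (Hh : 0 < h) by (apply Rmin_pos; lra).
  assert (Hr : Rabs h < d) by (rewrite Rabs_pos_eq; lra).
  specialize (Hdd h ltac:(lra) Hr).
  apply Rabs_def2 in Hdd. destruct Hdd as [_ Hdd].
  exists (a + h). split; [lra|].
  assert (H3 : 0 < (v (a + h) - v a) / h) by lra.
  assert (H4 : (v (a + h) - v a) = (v (a + h) - v a) / h * h) by (field; lra).
  assert (H5 := Rmult_lt_0_compat _ _ H3 Hh). lra.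
Qed.

(* A maximum over [a, b] of a function that increases wherever it is
   nonnegative can only sit at b. *)
Lemma pos_of_increasing_where_nonneg (v dv : R -> R) (a b : R) :
  a < b ->
  (forall t, a <= t <= b -> is_derive v t (dv t)) ->
  (forall t, a <= t < b -> 0 <= v t -> 0 < dv t) ->
  0 <= v a -> 0 < v b.
Proof.
  intros Hab Hd Hpos Ha.
  destruct (continuity_ab_maj v a b) as [m [Hm Hmab]]; [lra| |].
  - intros c Hc. exact (is_derive_continuity_pt _ _ _ (Hd c Hc)).
  - assert (Hma := Hm a ltac:(lra)).
    assert (Hnomax : forall t, a <= t < b -> 0 <= v t ->
              exists c, a <= c <= b /\ v t < v c).
    { intros t Ht Hvt.
      destruct (not_max_of_pos_derive v (dv t) t b) as [c [Hc Hv]];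
        [lra | apply Hd; lra | now apply Hpos |].
      exists c. split; [lra | exact Hv]. }
    assert (Hmb : m = b).
    { destruct (Rle_lt_or_eq_dec m b) as [Hlt | Heq]; [lra | | exact Heq].
      destruct (Hnomax m) as [c [Hc Hv]]; [lra | lra |].
      specialize (Hm c Hc). lra. }
    subst m.
    destruct (Hnomax a) as [c [Hc Hv]]; [lra | lra |].
    specialize (Hm c Hc). lra.
Qed.

(* A positive solution of [x v' > v^2] blows up, because [1 / v + ln x] decreases. *)
Lemma no_global_supersolution (v dv : R -> R) (a : R) :
  0 < a ->
  (forall x, a <= x -> is_derive v x (dv x)) ->
  (forall x, a <= x -> 0 < v x) ->
  (forall x, a <= x -> v x ^ 2 < x * dv x) -> False.
Proof.
  intros Ha Hd Hv Hdv.
  (* This [b] satisfies ln b = ln a + 1 / v a. The growth of the logarithm then uses up all of 1 / v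
     a, so a decreasing 1 / v + ln would force 1 / v b < 0. *)
  set (b := a * exp (/ v a)).
  assert (Hva := Hv a ltac:(lra)).
  assert (Hiv : 0 < / v a) by now apply Rinv_0_lt_compat.
  assert (Hab : a < b).
  { unfold b. assert (1 < exp (/ v a)) by (rewrite <- exp_0; apply exp_increasing; exact Hiv). nra. }
  assert (Hdf : forall x, a <= x ->
     is_derive (fun t => / v t + ln t) x (- dv x / v x ^ 2 + / x)).
  { intros x Hx.
    specialize (Hv x Hx). specialize (Hd x Hx).
    apply (is_derive_plus (fun t => / v t) ln x).
    - apply (is_derive_inv v x (dv x)); [exact Hd | lra].
    - apply is_derive_Reals. apply derivable_pt_lim_ln. lra. }
  destruct (MVT_gen (fun t => / v t + ln t) a b
              (fun x => - dv x / v x ^ 2 + / x)) as [c [Hc Heq]].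
  - intros x Hx. rewrite Rmin_left, Rmax_right in Hx by lra. apply Hdf. lra.
  - intros x Hx. rewrite Rmin_left, Rmax_right in Hx by lra.
    eapply is_derive_continuity_pt. apply Hdf. lra.
  - rewrite Rmin_left, Rmax_right in Hc by lra.
    assert (Hvb := Hv b ltac:(lra)).
    assert (Hib : 0 < / v b) by now apply Rinv_0_lt_compat.
    assert (Hlb : ln b = ln a + / v a).
    { unfold b. rewrite ln_mult by (try apply exp_pos; lra). now rewrite ln_exp. }
    assert (Hvc := Hv c ltac:(lra)). assert (Hdc := Hdv c ltac:(lra)).
    assert (Hneg : - dv c / v c ^ 2 + / c < 0).
    { replace (- dv c / v c ^ 2 + / c)
        with (- ((c * dv c - v c ^ 2) / (c * v c ^ 2))) by (field; lra).
      enough (0 < (c * dv c - v c ^ 2) / (c * v c ^ 2)) by lra.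
      apply Rdiv_lt_0_compat; [lra|].
      apply Rmult_lt_0_compat; [lra | now apply pow_lt]. }
    rewrite Hlb in Heq. nra.
Qed.

(** * The explicit bounds and their defect in the Riccati equation *)

Definition cosine (nu x : R) : R := nu / sqrt (nu ^ 2 + x ^ 2).

Definition shrunk_order (nu x : R) : R :=
  sqrt (nu ^ 2 - x ^ 4 / (4 * (x ^ 2 + nu ^ 2) ^ 2)).

Definition shifted_order (sg nu x : R) : R :=
  sg * cosine nu x + shrunk_order nu x.

Definition radical (sg nu x : R) : R :=
  sqrt (x ^ 2 + shifted_order sg nu x ^ 2).

(* [sg = 1] is the bound L for y; [sg = -1] is minus the bound for z, since [- z]
   solves the same equation as y. *)
Definition riccati_bound (sg nu x : R) : R :=
  - (1 / 2 * (1 + nu ^ 2 / (nu ^ 2 + x ^ 2))) + sg * radical sg nu x.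

Section Bounds.

Variables (nu x : R).
Hypothesis hnu : 1 / 2 <= nu.

(** For a right triangle with legs [nu] and [x], [r] is the cosine of the angle next to [nu]; [q]
    and [p] are the squares of its cosine and sine. *)
Let N := nu ^ 2 + x ^ 2.
Let q := nu ^ 2 / N.
Let p := x ^ 2 / N.
Let r := cosine nu x.
Let T := shrunk_order nu x.

Lemma sum_sqr_pos : 0 < N.
Proof. unfold N. nra. Qed.

Lemma sin2_add_cos2 : p + q = 1.
Proof. unfold p, q. assert (H := sum_sqr_pos). unfold N in *. field. lra. Qed.

Lemma sin2_nonneg : 0 <= p.
Proof.
  unfold p. apply Rmult_le_pos; [nra | left; apply Rinv_0_lt_compat, sum_sqr_pos].
Qed.

Lemma cos2_pos : 0 < q.
Proof. unfold q. apply Rdiv_lt_0_compat; [nra | apply sum_sqr_pos]. Qed.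

Lemma cosine_pos : 0 < r.
Proof.
  unfold r, cosine. apply Rdiv_lt_0_compat; [lra | apply sqrt_lt_R0, sum_sqr_pos].
Qed.

Lemma cosine_sqr : r ^ 2 = q.
Proof.
  unfold r, cosine, q. assert (H := sum_sqr_pos). fold N.
  assert (Hs := pow2_sqrt N ltac:(lra)).
  assert (Hp : 0 < sqrt N) by (apply sqrt_lt_R0; lra).
  rewrite <- Hs at 2. field. lra.
Qed.

Lemma shrunk_order_arg : nu ^ 2 - x ^ 4 / (4 * (x ^ 2 + nu ^ 2) ^ 2) = nu ^ 2 - p ^ 2 / 4.
Proof. unfold p. assert (H := sum_sqr_pos). unfold N in *. field. lra. Qed.

(** Since nu^2 >= 1/4 and p^2 <= p, the right side is at least (1 - p) / 4. This keeps [T] real and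
    positive. *)
Lemma shrunk_order_arg_ge : q / 4 <= nu ^ 2 - p ^ 2 / 4.
Proof. assert (H1 := sin2_add_cos2). assert (H2 := sin2_nonneg). assert (H3 := cos2_pos). nra. Qed.

Lemma shrunk_order_pos : 0 < T.
Proof.
  unfold T, shrunk_order. apply sqrt_lt_R0. rewrite shrunk_order_arg.
  assert (H1 := shrunk_order_arg_ge). assert (H3 := cos2_pos). lra.
Qed.

Lemma shrunk_order_sqr : T ^ 2 = nu ^ 2 - p ^ 2 / 4.
Proof.
  unfold T, shrunk_order. rewrite shrunk_order_arg. apply pow2_sqrt.
  assert (H1 := shrunk_order_arg_ge). assert (H3 := cos2_pos). lra.
Qed.

(** For [sg = -1] this says W + T = 2 T - r >= 0, which limits how negative [W] can be. *)
Lemma shrunk_order_ge : r / 2 <= T.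
Proof.
  assert (H1 := shrunk_order_arg_ge).
  rewrite <- shrunk_order_sqr, <- cosine_sqr in H1.
  assert (H2 := shrunk_order_pos). assert (H3 := cosine_pos). nra.
Qed.

Lemma is_derive_cosine : is_derive (cosine nu) x (- x * r / N).
Proof.
  assert (H := sum_sqr_pos). unfold cosine.
  assert (Hp : 0 < sqrt N) by (apply sqrt_lt_R0; lra).
  assert (Hs := pow2_sqrt N ltac:(lra)).
  unfold r, cosine. fold N.
  auto_derive; replace (nu * (nu * 1) + x * (x * 1)) with N by (unfold N; ring).
  - repeat split; lra.
  - set (s := sqrt N) in *. clearbody s. rewrite <- Hs. field. lra.
Qed.

Lemma is_derive_shrunk_order :
  is_derive (shrunk_order nu) x (- (x ^ 3 * nu ^ 2) / (2 * N ^ 3 * T)).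
Proof.
  assert (H := sum_sqr_pos). assert (HT := shrunk_order_pos).
  assert (Ha : 0 < nu ^ 2 - x ^ 4 / (4 * (x ^ 2 + nu ^ 2) ^ 2)).
  { rewrite shrunk_order_arg.
    assert (H1 := shrunk_order_arg_ge). assert (H3 := cos2_pos). lra. }
  assert (Hi : is_derive (fun x => nu ^ 2 - x ^ 4 / (4 * (x ^ 2 + nu ^ 2) ^ 2)) x
                 (- (x ^ 3 * nu ^ 2) / N ^ 3)).
  { auto_derive.
    - unfold N in H. simpl in H. nra.
    - unfold N in *. field. lra. }
  unfold shrunk_order.
  evar_last; [apply (is_derive_sqrt _ x _ Hi Ha)|].
  fold (shrunk_order nu x). fold T. field. lra.
Qed.

Variable sg : R.
Hypothesis hsg : sg = 1 \/ sg = -1.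

Let W := shifted_order sg nu x.
Let S := radical sg nu x.

(** Assumed in place of 0 < x, so that the derivative at x = 0 is covered when [sg = 1]. For
    [sg = -1] and nu = 1 the radicand vanishes at x = 0. *)
Hypothesis hS : 0 < x ^ 2 + W ^ 2.

Lemma radical_pos : 0 < S.
Proof. apply sqrt_lt_R0, hS. Qed.

Lemma radical_sqr : S ^ 2 = x ^ 2 + W ^ 2.
Proof. apply pow2_sqrt. fold W. lra. Qed.

Definition riccati_bound_derivative : R :=
  x * nu ^ 2 / N ^ 2
  + sg * ((x + W * (sg * (- x * r / N) - (x ^ 3 * nu ^ 2) / (2 * N ^ 3 * T))) / S).

Lemma is_derive_riccati_bound :
  is_derive (riccati_bound sg nu) x riccati_bound_derivative.
Proof.
  assert (H := sum_sqr_pos). assert (HT := shrunk_order_pos). assert (HS := radical_pos).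
  assert (Hq : is_derive (fun x => - (1 / 2 * (1 + nu ^ 2 / (nu ^ 2 + x ^ 2)))) x
                 (x * nu ^ 2 / N ^ 2)).
  { auto_derive; unfold N in *; [simpl in H; lra | field; lra]. }
  assert (HW : is_derive (shifted_order sg nu) x
     (sg * (- x * r / N) + - (x ^ 3 * nu ^ 2) / (2 * N ^ 3 * T))).
  { apply (is_derive_plus (fun x => sg * cosine nu x) (shrunk_order nu) x).
    - apply (is_derive_scal (cosine nu) x sg). apply is_derive_cosine.
    - apply is_derive_shrunk_order. }
  assert (Hi : is_derive (fun x => x ^ 2 + shifted_order sg nu x ^ 2) x
     (2 * x + 2 * W * (sg * (- x * r / N) + - (x ^ 3 * nu ^ 2) / (2 * N ^ 3 * T)))).
  { apply (is_derive_plus (fun x => x ^ 2) (fun x => shifted_order sg nu x ^ 2) x).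
    - auto_derive; [easy | ring].
    - evar_last; [apply (is_derive_pow _ 2 x _ HW)|]. fold W. simpl. ring. }
  apply (is_derive_plus _ (fun x => sg * radical sg nu x) x _ _ Hq).
  apply (is_derive_scal (radical sg nu) x sg).
  evar_last; [apply (is_derive_sqrt _ x _ Hi hS)|].
  fold S. fold (radical sg nu x). fold S. field. lra.
Qed.

(** The relations x^2 = S^2 - W^2, nu^2 = T^2 + p^2/4, p = 1 - r^2 and W = sg r + T leave only [S],
    [T] and [r]; what remains is an identity of rational functions, checked for each sign. *)
Lemma riccati_defect :
  (x ^ 2 + nu ^ 2 - riccati_bound sg nu x ^ 2 - x * riccati_bound_derivative) * (sg * S)
  = (W - r * S) ^ 2 + p * sg * r * (W - r * S) + p ^ 2 * q * W / (2 * T).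
Proof.
  assert (H := sum_sqr_pos). assert (HT := shrunk_order_pos). assert (HS := radical_pos).
  assert (Hb : riccati_bound sg nu x = - (1 / 2 * (1 + q)) + sg * S) by reflexivity.
  assert (Hd : x * riccati_bound_derivative
    = p * q + sg * ((x ^ 2 - W * (sg * p * r + p ^ 2 * q / (2 * T))) / S)).
  { unfold riccati_bound_derivative, p, q. field. lra. }
  rewrite Hb, Hd.
  assert (Hp : p = 1 - r ^ 2) by (rewrite cosine_sqr; assert (h := sin2_add_cos2); lra).
  assert (Hx : x ^ 2 = S ^ 2 - W ^ 2) by (rewrite radical_sqr; ring).
  assert (Hn : nu ^ 2 = T ^ 2 + p ^ 2 / 4) by (rewrite shrunk_order_sqr; lra).
  assert (HW : W = sg * r + T) by reflexivity.
  rewrite Hx, Hn, Hp, <- cosine_sqr.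
  clearbody W S T r. rewrite HW.
  destruct hsg as [-> | ->]; field; lra.
Qed.

End Bounds.

(** With D = W - r S, completing the square gives D^2 + p r D >= - p^2 r^2 / 4, while W = T + r
    makes the last term of the defect exceed p^2 r^2 / 2. *)
Lemma riccati_bound_lower (nu x : R) :
  1 / 2 <= nu -> 0 < x ->
  x * riccati_bound_derivative nu x 1 < x ^ 2 + nu ^ 2 - riccati_bound 1 nu x ^ 2.
Proof.
  intros hnu hx.
  assert (hS : 0 < x ^ 2 + shifted_order 1 nu x ^ 2) by nra.
  assert (Hdef := riccati_defect nu x hnu 1 (or_introl eq_refl) hS).
  assert (HS := radical_pos nu x 1 hS).
  assert (HT := shrunk_order_pos nu x hnu). assert (Hr := cosine_pos nu x hnu).
  assert (Hq := cos2_pos nu x hnu).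
  assert (Hp : 0 < x ^ 2 / (nu ^ 2 + x ^ 2)) by (apply Rdiv_lt_0_compat; nra).
  assert (Hqr := cosine_sqr nu x hnu).
  set (q := nu ^ 2 / (nu ^ 2 + x ^ 2)) in *.
  set (p := x ^ 2 / (nu ^ 2 + x ^ 2)) in *.
  set (W := shifted_order 1 nu x) in *.
  set (T := shrunk_order nu x) in *.
  set (r := cosine nu x) in *.
  set (S := radical 1 nu x) in *.
  assert (Hlast : p ^ 2 * q / 2 < p ^ 2 * q * W / (2 * T)).
  { replace (p ^ 2 * q * W / (2 * T)) with (p ^ 2 * q / 2 + p ^ 2 * q * r / (2 * T)).
    - enough (0 < p ^ 2 * q * r / (2 * T)) by lra.
      apply Rdiv_lt_0_compat; [|lra].
      apply Rmult_lt_0_compat; [|lra].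
      apply Rmult_lt_0_compat; [apply pow_lt|]; lra.
    - unfold W, shifted_order. fold r T. field. lra. }
  rewrite <- Hqr in Hlast.
  rewrite <- Hqr in Hdef.
  set (Z := p ^ 2 * r ^ 2 * W / (2 * T)) in *.
  assert (Hsq := pow2_ge_0 (W - r * S + p * r / 2)).
  assert (Hpr := pow2_ge_0 (p * r)).
  set (X := x ^ 2 + nu ^ 2 - riccati_bound 1 nu x ^ 2) in *.
  set (Y := x * riccati_bound_derivative nu x 1) in *.
  assert (0 < (X - Y) * (1 * S)) by (rewrite Hdef; nra).
  nra.
Qed.

Lemma riccati_bound_upper (nu x : R) :
  1 / 2 <= nu -> 0 < x ->
  x ^ 2 + nu ^ 2 - riccati_bound (-1) nu x ^ 2 < x * riccati_bound_derivative nu x (-1).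
Proof.
  intros hnu hx.
  assert (hS : 0 < x ^ 2 + shifted_order (-1) nu x ^ 2) by nra.
  assert (Hdef := riccati_defect nu x hnu (-1) (or_intror eq_refl) hS).
  assert (HS := radical_pos nu x (-1) hS).
  assert (HS2 := radical_sqr nu x (-1) hS).
  assert (HT := shrunk_order_pos nu x hnu). assert (Hr := cosine_pos nu x hnu).
  assert (HTr := shrunk_order_ge nu x hnu).
  assert (HT2 := shrunk_order_sqr nu x hnu).
  assert (Hq := cos2_pos nu x hnu).
  assert (Hp : 0 < x ^ 2 / (nu ^ 2 + x ^ 2)) by (apply Rdiv_lt_0_compat; nra).
  assert (Hpq := sin2_add_cos2 nu x hnu).
  assert (Hqr := cosine_sqr nu x hnu).
  assert (Hqx : nu ^ 2 / (nu ^ 2 + x ^ 2) * x ^ 2 = x ^ 2 / (nu ^ 2 + x ^ 2) * nu ^ 2)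
    by (field; nra).
  set (q := nu ^ 2 / (nu ^ 2 + x ^ 2)) in *.
  set (p := x ^ 2 / (nu ^ 2 + x ^ 2)) in *.
  set (T := shrunk_order nu x) in *.
  set (r := cosine nu x) in *.
  assert (HW : shifted_order (-1) nu x = T - r) by (unfold shifted_order; fold r T; ring).
  set (W := shifted_order (-1) nu x) in *.
  set (S := radical (-1) nu x) in *.
  set (X := x ^ 2 + nu ^ 2 - riccati_bound (-1) nu x ^ 2) in *.
  set (Y := x * riccati_bound_derivative nu x (-1)) in *.
  (* From W + T >= 0, that is W / T >= -1. *)
  assert (HWT : - (p ^ 2 * q / 2) <= p ^ 2 * q * W / (2 * T)).
  { replace (p ^ 2 * q * W / (2 * T))
      with (- (p ^ 2 * q / 2) + p ^ 2 * q * ((W + T) / (2 * T))) by (field; lra).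
    enough (0 <= p ^ 2 * q * ((W + T) / (2 * T))) by lra.
    apply Rmult_le_pos; [assert (h := pow2_ge_0 p); nra|].
    apply Rmult_le_pos; [lra | left; apply Rinv_0_lt_compat; lra]. }
  assert (HrS : 0 < r * S) by nra.
  (* The factor -S is negative, so a positive right side in [riccati_defect] gives the reversed
     inequality. There - p r D > 0 as soon as D = W - r S < 0. *)
  enough (Hpos : 0 < (X - Y) * (-1 * S)) by nra.
  rewrite Hdef.
  destruct (Rle_lt_dec 0 W) as [HW0 | HW0].
  - assert (HD : W - r * S < 0).
    { (* [W < T <= nu], hence [W^2 < q (x^2 + W^2)]. *)
      enough (W ^ 2 < (r * S) ^ 2) by nra.
      replace ((r * S) ^ 2) with (q * x ^ 2 + q * W ^ 2) by (rewrite <- Hqr; nra).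
      rewrite Hqx. assert (W < T) by lra.
      assert (W ^ 2 < nu ^ 2) by (assert (h := pow2_ge_0 p); nra). nra. }
    assert (Hz : 0 <= p ^ 2 * q * W / (2 * T)).
    { apply Rmult_le_pos; [|left; apply Rinv_0_lt_compat; lra].
      apply Rmult_le_pos; [assert (h := pow2_ge_0 p); nra | lra]. }
    assert (0 < p * r) by nra. nra.
  (* For W < 0, D^2 >= r^2 S^2 >= q x^2 = p nu^2 >= p/4, whereas the last term costs at most p^2 q /
     2 <= p/8, because p + q = 1 forces p q <= 1/4. *)
  - assert (HD : r * S < - (W - r * S)) by lra.
    assert (HD2 : p / 4 <= (W - r * S) ^ 2).
    { assert (q * x ^ 2 <= (r * S) ^ 2).
      { replace ((r * S) ^ 2) with (q * x ^ 2 + q * W ^ 2) by (rewrite <- Hqr; nra).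
        assert (h := pow2_ge_0 W). nra. }
      assert (1 / 4 <= nu ^ 2) by nra. nra. }
    assert (0 < p * r) by nra.
    assert (p ^ 2 * q / 2 <= p / 8).
    { assert (p * q <= 1 / 4) by (assert (h := pow2_ge_0 (p - q)); nra). nra. }
    nra.
Qed.

(** * The entire factor of I_nu *)

Lemma exp_le (a b : R) : a <= b -> exp a <= exp b.
Proof.
  intros [H | ->]; [left; now apply exp_increasing | lra].
Qed.

(** * Gauss's limit: convergence, positivity and functional equation of 1 / Gamma *)

Definition rGamma_seq (z : R) (n : nat) : R :=
  prod_f_R0 (fun k => z + INR k) n / (INR (fact n) * Rpower (INR n) z).

Lemma prod_shifted_pos (z : R) (n : nat) :
  0 < z -> 0 < prod_f_R0 (fun k => z + INR k) n.
Proof.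
  intros Hz. induction n as [|n IH].
  - simpl. lra.
  - assert (H := pos_INR (S n)).
    cbn [prod_f_R0]. apply Rmult_lt_0_compat; lra.
Qed.

Lemma rGamma_seq_pos (z : R) (n : nat) : 0 < z -> 0 < rGamma_seq z n.
Proof.
  intros Hz. apply Rdiv_lt_0_compat; [now apply prod_shifted_pos|].
  apply Rmult_lt_0_compat; [apply INR_fact_lt_0 | apply exp_pos].
Qed.

Lemma ln_succ_ge (m : R) : 0 < m -> ln m + / (m + 1) <= ln (m + 1).
Proof.
  intros Hm.
  assert (Hi : 0 < / (m + 1)) by (apply Rinv_0_lt_compat; lra).
  assert (H : m <= (m + 1) * exp (- / (m + 1))).
  { assert (h := exp_ineq1_le (- / (m + 1))).
    replace m with ((m + 1) * (1 + - / (m + 1))) at 1 by (field; lra).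
    apply Rmult_le_compat_l; lra. }
  assert (H2 := ln_le _ _ Hm H).
  rewrite ln_mult, ln_exp in H2; [lra | lra | apply exp_pos].
Qed.

(** In the form (1 + 1/m)^z >= 1 + z / (m + 1), this makes the ratio of consecutive Gauss quotients
    at most 1. *)
Lemma Rpower_succ_ge (m z : R) :
  0 < m -> 0 <= z -> Rpower m z * (m + 1 + z) <= (m + 1) * Rpower (m + 1) z.
Proof.
  intros Hm Hz.
  assert (H1 := exp_ineq1_le (z * / (m + 1))).
  assert (H2 : Rpower m z * exp (z * / (m + 1)) <= Rpower (m + 1) z).
  { unfold Rpower. rewrite <- exp_plus. apply exp_le.
    assert (h := ln_succ_ge m Hm). nra. }
  assert (H3 : 0 < Rpower m z) by apply exp_pos.
  replace (Rpower m z * (m + 1 + z)) with ((m + 1) * (Rpower m z * (1 + z * / (m + 1))))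
    by (field; lra).
  apply Rmult_le_compat_l; [lra|]. nra.
Qed.

(** The tangent of exp at z a lies below exp at the points a and 0; the two inequalities are
    combined with weights z and 1 - z. *)
Lemma exp_convex_unit (z a : R) : 0 <= z <= 1 -> exp (z * a) <= 1 - z + z * exp a.
Proof.
  intros Hz.
  assert (H1 := exp_ineq1_le ((1 - z) * a)).
  assert (H2 := exp_ineq1_le (- (z * a))).
  assert (He := exp_pos (z * a)).
  assert (E1 : exp a = exp (z * a) * exp ((1 - z) * a))
    by (rewrite <- exp_plus; f_equal; ring).
  assert (E2 : 1 = exp (z * a) * exp (- (z * a)))
    by (rewrite <- exp_plus, <- exp_0; f_equal; ring).
  set (e := exp (z * a)) in *.
  assert (H3 : e * (1 + (1 - z) * a) <= exp a) by (rewrite E1; nra).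
  assert (H4 : e * (1 - z * a) <= 1) by (rewrite E2 at 2; nra).
  nra.
Qed.

(** Bernoulli's inequality (1 + 1/m)^z <= 1 + z / m, from convexity of exp with a = ln ((m + 1) /
    m). *)
Lemma Rpower_succ_le (m z : R) :
  0 < m -> 0 <= z <= 1 -> m * Rpower (m + 1) z <= Rpower m z * (m + z).
Proof.
  intros Hm Hz.
  assert (H := exp_convex_unit z (ln (m + 1) - ln m) Hz).
  replace (z * (ln (m + 1) - ln m)) with (z * ln (m + 1) + - (z * ln m)) in H by ring.
  rewrite exp_plus in H.
  replace (ln (m + 1) - ln m) with (ln (m + 1) + - ln m) in H by ring.
  rewrite exp_plus, (exp_Ropp (ln m)), (exp_Ropp (z * ln m)), !exp_ln in H by lra.
  fold (Rpower (m + 1) z) in H. fold (Rpower m z) in H.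
  assert (H3 : 0 < Rpower m z) by apply exp_pos.
  apply (Rmult_le_compat_l (m * Rpower m z)) in H; [|nra].
  replace (m * Rpower m z * (Rpower (m + 1) z * / Rpower m z))
    with (m * Rpower (m + 1) z) in H by (field; lra).
  replace (m * Rpower m z * (1 - z + z * ((m + 1) * / m)))
    with (Rpower m z * (m + z)) in H by (field; lra).
  exact H.
Qed.

(** Monotonicity is stated from index 1 on: at index 0 the power has base 0, where [Rpower] is
    meaningless. *)
Lemma rGamma_seq_decreasing (z : R) (n : nat) :
  0 < z -> rGamma_seq z (S (S n)) <= rGamma_seq z (S n).
Proof.
  intros Hz.
  assert (Hm : 0 < INR (S n)) by (apply lt_0_INR; lia).
  assert (HP := prod_shifted_pos z (S n) Hz).
  assert (Hf := INR_fact_lt_0 (S n)).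
  unfold rGamma_seq.
  change (prod_f_R0 (fun k => z + INR k) (S (S n)))
    with (prod_f_R0 (fun k => z + INR k) (S n) * (z + INR (S (S n)))).
  rewrite (fact_simpl (S n)), mult_INR, (S_INR (S n)).
  set (m := INR (S n)) in *.
  set (P := prod_f_R0 _ _) in *. set (F := INR (fact (S n))) in *.
  assert (H := Rpower_succ_ge m z Hm ltac:(lra)).
  assert (H1 : 0 < Rpower m z) by apply exp_pos.
  assert (H2 : 0 < Rpower (m + 1) z) by apply exp_pos.
  clearbody m P F.
  set (A := Rpower m z) in *. set (B := Rpower (m + 1) z) in *. clearbody A B.
  replace (P / (F * A)) with (P / (F * A * ((m + 1) * B)) * ((m + 1) * B))
    by (field; lra).
  replace (P * (z + (m + 1)) / ((m + 1) * F * B))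
    with (P / (F * A * ((m + 1) * B)) * (A * (m + 1 + z))) by (field; lra).
  apply Rmult_le_compat_l; [|exact H].
  left. apply Rdiv_lt_0_compat; [lra|].
  repeat apply Rmult_lt_0_compat; lra.
Qed.

Lemma is_lim_rGamma (z : R) : 0 < z -> is_lim_seq (rGamma_seq z) (rGamma z).
Proof.
  intros Hz. apply Lim_seq_correct'.
  destruct (ex_finite_lim_seq_decr (fun n => rGamma_seq z (S n)) 0) as [l Hl].
  - intros n. now apply rGamma_seq_decreasing.
  - intros n. left. now apply rGamma_seq_pos.
  - exists l. now apply is_lim_seq_incr_1.
Qed.

(** Each new factor is handled by Bernoulli's inequality with m = n + 1. The base n + 1 instead of n
    lets the induction start at n = 0, with equality. *)
Lemma prod_shifted_lower (z : R) (n : nat) :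
  0 < z <= 1 ->
  z * INR (fact n) * Rpower (INR n + 1) z <= prod_f_R0 (fun k => z + INR k) n.
Proof.
  intros Hz. induction n as [|n IH].
  - cbn [prod_f_R0 fact INR]. rewrite Rplus_0_l.
    unfold Rpower. rewrite ln_1, Rmult_0_r, exp_0. lra.
  - cbn [prod_f_R0]. rewrite fact_simpl, mult_INR, S_INR.
    assert (Hn := pos_INR n). assert (Hf := INR_fact_lt_0 n).
    assert (H := Rpower_succ_le (INR n + 1) z ltac:(lra) ltac:(lra)).
    apply Rle_trans with (z * INR (fact n) * Rpower (INR n + 1) z * (z + (INR n + 1))).
    + replace (z * ((INR n + 1) * INR (fact n)) * Rpower (INR n + 1 + 1) z)
        with (z * INR (fact n) * ((INR n + 1) * Rpower (INR n + 1 + 1) z)) by ring.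
      rewrite (Rmult_assoc (z * INR (fact n))).
      apply Rmult_le_compat_l; [nra | lra].
    + apply Rmult_le_compat_r; lra.
Qed.

(** A decreasing positive sequence could still tend to 0; here every Gauss quotient from index 1 on
    is at least z, hence so is the limit. *)
Lemma rGamma_pos_le1 (z : R) : 0 < z <= 1 -> 0 < rGamma z.
Proof.
  intros Hz.
  enough (H : Rbar_le z (rGamma z)) by (simpl in H; lra).
  apply (is_lim_seq_le (fun _ => z) (fun n => rGamma_seq z (S n))).
  - intros n. unfold rGamma_seq.
    assert (Hm : 0 < INR (S n)) by (apply lt_0_INR; lia).
    assert (H := prod_shifted_lower z (S n) Hz).
    assert (Hf := INR_fact_lt_0 (S n)).
    assert (Hr : Rpower (INR (S n)) z <= Rpower (INR (S n) + 1) z)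
      by (apply Rle_Rpower_l; lra).
    assert (Hr0 : 0 < Rpower (INR (S n)) z) by apply exp_pos.
    apply (Rmult_le_reg_r (INR (fact (S n)) * Rpower (INR (S n)) z)); [nra|].
    unfold Rdiv at 1. rewrite Rmult_assoc, Rinv_l, Rmult_1_r by nra.
    eapply Rle_trans; [|exact H]. rewrite <- Rmult_assoc.
    apply Rmult_le_compat_l; [nra | exact Hr].
  - apply is_lim_seq_const.
  - apply (is_lim_seq_incr_1 (rGamma_seq z)). now apply is_lim_rGamma.
Qed.

Lemma prod_shifted_succ (z : R) (n : nat) :
  z * prod_f_R0 (fun k => z + 1 + INR k) n
  = prod_f_R0 (fun k => z + INR k) n * (z + INR n + 1).
Proof.
  induction n as [|n IH].
  - simpl. ring.
  - cbn [prod_f_R0]. rewrite <- Rmult_assoc, IH, S_INR. ring.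
Qed.

(** The n-th quotient for z + 1, multiplied by z, is the n-th quotient for z times 1 + (z + 1) / n,
    a factor tending to 1. *)
Lemma rGamma_rec (z : R) : 0 < z -> rGamma z = z * rGamma (z + 1).
Proof.
  intros Hz.
  assert (H1 : is_lim_seq (fun n => z * rGamma_seq (z + 1) (S n)) (z * rGamma (z + 1))).
  { apply (is_lim_seq_scal_l _ z (rGamma (z + 1))).
    apply (is_lim_seq_incr_1 (rGamma_seq (z + 1))). apply is_lim_rGamma. lra. }
  assert (H2 : is_lim_seq (fun n => rGamma_seq z (S n) * (1 + (z + 1) * / INR (S n)))
                 (rGamma z * (1 + (z + 1) * 0))).
  { apply is_lim_seq_mult'.
    - apply (is_lim_seq_incr_1 (rGamma_seq z)). now apply is_lim_rGamma.
    - apply is_lim_seq_plus'; [apply is_lim_seq_const|].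
      apply is_lim_seq_mult'; [apply is_lim_seq_const|].
      apply (is_lim_seq_incr_1 (fun n => / INR n)).
      apply (is_lim_seq_inv INR p_infty); [apply is_lim_seq_INR | easy]. }
  apply (is_lim_seq_ext _ (fun n => z * rGamma_seq (z + 1) (S n))) in H2.
  - apply is_lim_seq_unique in H1. apply is_lim_seq_unique in H2.
    rewrite H1 in H2. injection H2 as H2. lra.
  - intros n. unfold rGamma_seq.
    assert (Hm : 0 < INR (S n)) by (apply lt_0_INR; lia).
    assert (Hf := INR_fact_lt_0 (S n)).
    assert (Hr0 : 0 < Rpower (INR (S n)) z) by apply exp_pos.
    unfold Rdiv at 2. rewrite <- Rmult_assoc, prod_shifted_succ.
    rewrite Rpower_plus, Rpower_1 by exact Hm.
    field. lra.
Qed.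

Lemma rGamma_pos (z : R) : 0 < z -> 0 < rGamma z.
Proof.
  intros Hz.
  (* Induction on an integer bound for the argument: the functional equation carries positivity from
     u - 1 to u, starting from (0, 1]. *)
  assert (H : forall n u, 0 < u <= INR n + 1 -> 0 < rGamma u).
  { induction n as [|n IH]; intros u Hu.
    - simpl in Hu. apply rGamma_pos_le1. lra.
    - destruct (Rle_lt_dec u 1) as [Hle | Hgt]; [apply rGamma_pos_le1; lra|].
      assert (h := IH (u - 1)). rewrite S_INR in Hu.
      rewrite rGamma_rec in h by lra.
      replace (u - 1 + 1) with u in h by ring.
      specialize (h ltac:(lra)). nra. }
  destruct (nfloor_ex z ltac:(lra)) as [n Hn].
  apply (H n). lra.
Qed.

(** * The power series in s = x^2 / 4 *)

Definition bessel_coef (nu : R) (k : nat) : R := rGamma (nu + INR k + 1) / INR (fact k).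

(** At s = x^2 / 4 this is (x/2)^(-nu) I_nu(x). Removing the power leaves a function that is
    differentiable at 0 as well, where the comparison for I_nu is anchored. *)
Definition bessel_entire (nu : R) : R -> R := PSeries (bessel_coef nu).

Lemma bessel_coef_pos (nu : R) (k : nat) : -1 < nu -> 0 < bessel_coef nu k.
Proof.
  intros Hnu. assert (H := pos_INR k).
  apply Rdiv_lt_0_compat; [apply rGamma_pos; lra | apply INR_fact_lt_0].
Qed.

(** Hence differentiating the series in s raises the order by one. *)
Lemma bessel_coef_succ (nu : R) (k : nat) :
  INR (S k) * bessel_coef nu (S k) = bessel_coef (nu + 1) k.
Proof.
  unfold bessel_coef. rewrite fact_simpl, mult_INR.
  assert (Hm : 0 < INR (S k)) by (apply lt_0_INR; lia).
  assert (Hf := INR_fact_lt_0 k).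
  replace (nu + INR (S k) + 1) with (nu + 1 + INR k + 1) by (rewrite S_INR; ring).
  field. lra.
Qed.

Lemma bessel_coef_pred (nu : R) (k : nat) :
  0 < nu -> bessel_coef (nu - 1) k = (nu + INR k) * bessel_coef nu k.
Proof.
  intros Hnu. unfold bessel_coef. assert (H := pos_INR k).
  replace (nu - 1 + INR k + 1) with (nu + INR k) by ring.
  rewrite rGamma_rec by lra. unfold Rdiv. ring.
Qed.

(** The ratio of consecutive coefficients is 1 / ((nu + 1 + n) (n + 1)), which is at most 1 / ((nu +
    1) (n + 1)). *)
Lemma bessel_coef_radius (nu : R) : -1 < nu -> CV_radius (bessel_coef nu) = p_infty.
Proof.
  intros Hnu. apply CV_radius_infinite_DAlembert.
  - intros n. apply Rgt_not_eq. now apply bessel_coef_pos.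
  - apply (is_lim_seq_le_le (fun _ => 0) _ (fun n => / (nu + 1) * / INR (S n))).
    + intros n.
      assert (Hm : 0 < INR (S n)) by (apply lt_0_INR; lia).
      assert (Hn := pos_INR n).
      assert (Hp := bessel_coef_pos nu n Hnu).
      assert (Hps := bessel_coef_pos nu (S n) Hnu).
      split; [apply Rabs_pos|].
      rewrite Rabs_pos_eq by (left; now apply Rdiv_lt_0_compat).
      assert (E := bessel_coef_pred (nu + 1) n ltac:(lra)).
      rewrite <- bessel_coef_succ in E.
      replace (nu + 1 - 1) with nu in E by ring.
      rewrite E.
      replace (bessel_coef nu (S n) / ((nu + 1 + INR n) * (INR (S n) * bessel_coef nu (S n))))
        with (/ (nu + 1 + INR n) * / INR (S n)) by (field; lra).
      apply Rmult_le_compat_r; [left; now apply Rinv_0_lt_compat|].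
      apply Rinv_le_contravar; lra.
    + apply is_lim_seq_const.
    + replace (Finite 0) with (Finite (/ (nu + 1) * 0)) by (f_equal; ring).
      apply is_lim_seq_mult'; [apply is_lim_seq_const|].
      apply (is_lim_seq_incr_1 (fun n => / INR n)).
      apply (is_lim_seq_inv INR p_infty); [apply is_lim_seq_INR | easy].
Qed.

Lemma ex_pseries_bessel (nu s : R) : -1 < nu -> ex_pseries (bessel_coef nu) s.
Proof. intros Hnu. apply CV_radius_inside. now rewrite bessel_coef_radius. Qed.

Lemma is_derive_bessel_entire (nu s : R) :
  -1 < nu -> is_derive (bessel_entire nu) s (bessel_entire (nu + 1) s).
Proof.
  intros Hnu. unfold bessel_entire.
  rewrite <- (PSeries_ext (PS_derive (bessel_coef nu))).
  - apply is_derive_PSeries. now rewrite bessel_coef_radius.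
  - intros n. apply bessel_coef_succ.
Qed.

(** The recurrence I_{nu-1} = (2 nu / x) I_nu + I_{nu+1} without its powers of x: in the coefficient
    (nu + k) a_k, the part k a_k is the series of order nu + 1 shifted by one place. *)
Lemma bessel_entire_rec (nu s : R) :
  0 < nu ->
  bessel_entire (nu - 1) s = nu * bessel_entire nu s + s * bessel_entire (nu + 1) s.
Proof.
  intros Hnu. unfold bessel_entire.
  rewrite <- PSeries_incr_1, <- PSeries_scal, <- PSeries_plus.
  - apply PSeries_ext. intros k.
    unfold PS_plus, PS_scal. rewrite bessel_coef_pred by exact Hnu.
    destruct k as [|k].
    + change ((nu + 0) * bessel_coef nu 0 = nu * bessel_coef nu 0 + 0). ring.
    + change (PS_incr_1 (bessel_coef (nu + 1)) (S k)) with (bessel_coef (nu + 1) k).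
      rewrite <- bessel_coef_succ.
      change ((nu + INR (S k)) * bessel_coef nu (S k)
              = nu * bessel_coef nu (S k) + INR (S k) * bessel_coef nu (S k)).
      ring.
  - apply ex_pseries_scal; [apply Rmult_comm | apply ex_pseries_bessel; lra].
  - apply ex_pseries_incr_1. apply ex_pseries_bessel; lra.
Qed.

Lemma bessel_entire_pos (nu s : R) : -1 < nu -> 0 <= s -> 0 < bessel_entire nu s.
Proof.
  intros Hnu Hs. unfold bessel_entire, PSeries.
  assert (Hex : ex_series (fun k => bessel_coef nu k * s ^ k)).
  { destruct (ex_pseries_bessel nu s Hnu) as [l Hl]. exists l. now apply is_pseries_R. }
  rewrite Series_incr_1 by exact Hex.
  assert (H0 := bessel_coef_pos nu 0 Hnu).
  enough (0 <= Series (fun k => bessel_coef nu (S k) * s ^ S k)) by (rewrite pow_O; lra).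
  set (t := fun k => bessel_coef nu (S k) * s ^ S k).
  (* Zero is written as the series of 0 times t, so that the comparison is made term by term. *)
  rewrite <- (Rmult_0_l (Series t)), <- Series_scal_l.
  apply Series_le.
  - intros n. assert (0 <= t n); [|lra].
    apply Rmult_le_pos; [left; now apply bessel_coef_pos | now apply pow_le].
  - now apply (ex_series_incr_1 (fun k => bessel_coef nu k * s ^ k)).
Qed.

(** * The logarithmic derivative of I_nu and the lower bound *)

Lemma BesselI_entire (nu x : R) :
  0 < x -> BesselI nu x = Rpower (x / 2) nu * bessel_entire nu (x ^ 2 / 4).
Proof.
  intros Hx. unfold BesselI, bessel_entire, PSeries.
  rewrite <- Series_scal_l. apply Series_ext. intros k.
  rewrite Rpower_plus.
  replace (2 * INR k) with (INR (2 * k)) by (rewrite mult_INR; simpl; ring).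
  rewrite Rpower_pow by lra. rewrite pow_mult.
  replace ((x / 2) ^ 2) with (x ^ 2 / 4) by field.
  unfold bessel_coef, Rdiv. ring.
Qed.

(** This is y = x I_nu' / I_nu, obtained by differentiating the logarithm of (x/2)^nu times the
    entire factor. Unlike that quotient, the formula makes sense at x = 0, with value nu. *)
Definition log_derivative_I (nu x : R) : R :=
  nu + x ^ 2 / 2 * (bessel_entire (nu + 1) (x ^ 2 / 4) / bessel_entire nu (x ^ 2 / 4)).

Lemma BesselI_ratio (nu x : R) :
  0 < nu -> 0 < x ->
  x * (BesselI (nu - 1) x / BesselI nu x) = nu + log_derivative_I nu x.
Proof.
  intros Hnu Hx. rewrite !BesselI_entire, bessel_entire_rec by lra.
  unfold log_derivative_I.
  assert (H := bessel_entire_pos nu (x ^ 2 / 4) ltac:(lra) ltac:(nra)).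
  assert (Hr : 0 < Rpower (x / 2) nu) by apply exp_pos.
  replace (Rpower (x / 2) (nu - 1)) with (Rpower (x / 2) nu / (x / 2)).
  - field. lra.
  - replace (nu - 1) with (nu + - (1)) by ring.
    rewrite Rpower_plus, Rpower_Ropp, Rpower_1 by lra. reflexivity.
Qed.

Definition log_derivative_I' (nu x : R) : R :=
  let a := bessel_entire nu (x ^ 2 / 4) in
  let b := bessel_entire (nu + 1) (x ^ 2 / 4) in
  let c := bessel_entire (nu + 1 + 1) (x ^ 2 / 4) in
  x * (b / a) + x ^ 3 / 4 * ((c * a - b * b) / a ^ 2).

Lemma is_derive_log_derivative_I (nu x : R) :
  0 < nu -> is_derive (log_derivative_I nu) x (log_derivative_I' nu x).
Proof.
  intros Hnu.
  assert (H := bessel_entire_pos nu (x ^ 2 / 4) ltac:(lra) ltac:(nra)).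
  assert (Hs : is_derive (fun x => x ^ 2 / 4) x (x / 2)) by (auto_derive; [easy | field]).
  assert (Ha : is_derive (fun x => bessel_entire nu (x ^ 2 / 4)) x
                 (x / 2 * bessel_entire (nu + 1) (x ^ 2 / 4))).
  { apply (is_derive_comp (bessel_entire nu) (fun x => x ^ 2 / 4) x); [|exact Hs].
    apply is_derive_bessel_entire. lra. }
  assert (Hb : is_derive (fun x => bessel_entire (nu + 1) (x ^ 2 / 4)) x
                 (x / 2 * bessel_entire (nu + 1 + 1) (x ^ 2 / 4))).
  { apply (is_derive_comp (bessel_entire (nu + 1)) (fun x => x ^ 2 / 4) x); [|exact Hs].
    apply is_derive_bessel_entire. lra. }
  assert (Hd := is_derive_div _ _ x _ _ Hb Ha ltac:(lra)).
  assert (Hh : is_derive (fun x => x ^ 2 / 2) x x) by (auto_derive; [easy | field]).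
  assert (Hm := is_derive_mult _ _ x _ _ Hh Hd Rmult_comm).
  assert (Hp := is_derive_plus _ _ x _ _ (is_derive_const nu x) Hm).
  unfold log_derivative_I'.
  set (a := bessel_entire nu (x ^ 2 / 4)) in *.
  set (b := bessel_entire (nu + 1) (x ^ 2 / 4)) in *.
  set (c := bessel_entire (nu + 1 + 1) (x ^ 2 / 4)) in *.
  replace (x * (b / a) + x ^ 3 / 4 * ((c * a - b * b) / a ^ 2))
    with (0 + (x * (b / a)
               + x ^ 2 / 2 * ((x / 2 * c * a - b * (x / 2 * b)) / a ^ 2)))
    by (field; lra).
  exact Hp.
Qed.

(** The recurrence at order nu + 1 replaces (x^2 / 4) c by a - (nu + 1) b; both sides then depend
    only on x, nu and b / a. *)
Lemma riccati_I (nu x : R) :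
  0 < nu ->
  x * log_derivative_I' nu x = x ^ 2 + nu ^ 2 - log_derivative_I nu x ^ 2.
Proof.
  intros Hnu. unfold log_derivative_I', log_derivative_I.
  assert (H := bessel_entire_pos nu (x ^ 2 / 4) ltac:(lra) ltac:(nra)).
  assert (E := bessel_entire_rec (nu + 1) (x ^ 2 / 4) ltac:(lra)).
  replace (nu + 1 - 1) with nu in E by ring.
  set (a := bessel_entire nu (x ^ 2 / 4)) in *.
  set (b := bessel_entire (nu + 1) (x ^ 2 / 4)) in *.
  set (c := bessel_entire (nu + 1 + 1) (x ^ 2 / 4)) in *.
  clearbody a b c.
  replace (x * (x * (b / a) + x ^ 3 / 4 * ((c * a - b * b) / a ^ 2)))
    with (x ^ 2 * (b / a) + x ^ 2 * (x ^ 2 / 4 * c) / a - x ^ 4 / 4 * (b / a) ^ 2)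
    by (field; lra).
  replace (x ^ 2 / 4 * c) with (a - (nu + 1) * b) by lra.
  field. lra.
Qed.

(** At x = 0 one has q = r = 1, T = nu and S = 1 + nu. *)
Lemma riccati_bound_at_0 (nu : R) : 1 / 2 <= nu -> riccati_bound 1 nu 0 = nu.
Proof.
  intros Hnu. unfold riccati_bound, radical, shifted_order, cosine, shrunk_order.
  replace (nu ^ 2 + 0 ^ 2) with (nu ^ 2) by ring.
  replace (nu ^ 2 - 0 ^ 4 / (4 * (0 ^ 2 + nu ^ 2) ^ 2)) with (nu ^ 2) by (field; nra).
  rewrite sqrt_pow2 by lra.
  replace (0 ^ 2 + (1 * (nu / nu) + nu) ^ 2) with ((1 + nu) ^ 2) by (field; lra).
  rewrite sqrt_pow2 by lra. field. nra.
Qed.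

(** If L >= y at x, follow L - y backwards from x to 0: wherever it is nonnegative it increases in
    that direction, so it would be positive at 0, where L = y = nu. *)
Lemma log_derivative_I_lower (nu x : R) :
  1 / 2 <= nu -> 0 < x -> riccati_bound 1 nu x < log_derivative_I nu x.
Proof.
  intros Hnu Hx. apply Rnot_le_lt. intros Hle.
  assert (Hd : forall u, is_derive (riccati_bound 1 nu) u (riccati_bound_derivative nu u 1)).
  { intros u. apply is_derive_riccati_bound; [exact Hnu|].
    assert (HW : 0 < shifted_order 1 nu u).
    { unfold shifted_order. assert (h1 := shrunk_order_pos nu u Hnu).
      assert (h2 := cosine_pos nu u Hnu). lra. }
    nra. }
  assert (H := pos_of_increasing_where_nonneg
    (fun t => riccati_bound 1 nu (x - t) - log_derivative_I nu (x - t))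
    (fun t => - (riccati_bound_derivative nu (x - t) 1 - log_derivative_I' nu (x - t)))
    0 x Hx).
  cbv beta in H. rewrite Rminus_0_r, Rminus_diag in H.
  rewrite riccati_bound_at_0 in H by exact Hnu.
  assert (E0 : log_derivative_I nu 0 = nu).
  { unfold log_derivative_I. replace (0 ^ 2 / 2) with 0 by field. ring. }
  rewrite E0 in H.
  enough (0 < nu - nu) by lra. apply H; [| |lra].
  - intros t _.
    assert (Hs : is_derive (fun t => x - t) t (-1)) by (auto_derive; [easy | ring]).
    assert (Hc := is_derive_comp _ _ t _ _
      (is_derive_minus _ _ (x - t) _ _ (Hd (x - t))
         (is_derive_log_derivative_I nu (x - t) ltac:(lra))) Hs).
    evar_last; [exact Hc|].
    unfold scal, minus, plus, opp; simpl. unfold mult; simpl. ring.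
  - intros t Ht Hv. set (u := x - t) in *. assert (Hu : 0 < u) by (unfold u; lra).
    assert (Hb := riccati_bound_lower nu u Hnu Hu).
    assert (Hr := riccati_I nu u ltac:(lra)).
    (* Since y >= nu > 0, the inequality L >= y passes to the squares in the Riccati equation. *)
    assert (Hy : nu <= log_derivative_I nu u).
    { unfold log_derivative_I.
      assert (h1 := bessel_entire_pos nu (u ^ 2 / 4) ltac:(lra) ltac:(nra)).
      assert (h2 := bessel_entire_pos (nu + 1) (u ^ 2 / 4) ltac:(lra) ltac:(nra)).
      assert (h3 := Rdiv_lt_0_compat _ _ h2 h1). nra. }
    nra.
Qed.

(** * The integral K_nu *)

Notation is_RInt_ray f l := (is_RInt_gen f (at_point 0) (Rbar_locally p_infty) l).

Lemma ray_forall (P : R * R -> Prop) :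
  (forall b, 0 <= b -> P (0, b)) ->
  filter_prod (at_point 0) (Rbar_locally p_infty) P.
Proof.
  intros H. apply (Filter_prod _ _ _ (fun a => a = 0) (fun b => 0 < b)).
  - reflexivity.
  - exists 0. easy.
  - intros a b -> Hb. apply H. lra.
Qed.

Lemma RInt_exp_opp (M T : R) : is_RInt (fun t => M * exp (- t)) 0 T (M - M * exp (- T)).
Proof.
  replace (M - M * exp (- T)) with (minus (- M * exp (- T)) (- M * exp (- 0)))
    by (rewrite Ropp_0, exp_0; unfold minus, plus, opp; simpl; ring).
  apply (is_RInt_derive (fun t => - M * exp (- t))).
  - intros t _. auto_derive; [easy | ring].
  - intros t _. apply (ex_derive_continuous (fun t => M * exp (- t))). auto_derive. easy.
Qed.

(** The integrals over [0, T] increase with T and stay below M, so they converge to their supremum.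
    That each of them is at most the limit later yields K_mu > 0. *)
Lemma is_RInt_ray_of_exp_bound (f : R -> R) (M : R) :
  (forall t, continuous f t) ->
  (forall t, 0 <= t -> 0 <= f t <= M * exp (- t)) ->
  exists l, is_RInt_ray f l /\ forall T, 0 <= T -> RInt f 0 T <= l.
Proof.
  intros Hc Hf.
  assert (Hex : forall a b, ex_RInt f a b).
  { intros a b. apply (ex_RInt_continuous (V := R_CompleteNormedModule)). intros; apply Hc. }
  assert (HM : 0 <= M).
  { assert (h := Hf 0 ltac:(lra)). rewrite Ropp_0, exp_0 in h. lra. }
  assert (Hmono : forall a b, 0 <= a <= b -> RInt f 0 a <= RInt f 0 b).
  { intros a b Hab. rewrite <- (RInt_Chasles f 0 a b) by apply Hex.
    assert (0 <= RInt f a b).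
    { apply RInt_ge_0; [lra | apply Hex |]. intros t Ht. apply Hf. lra. }
    unfold plus; simpl. lra. }
  destruct (completeness (fun y => exists T, 0 <= T /\ y = RInt f 0 T)) as [l [Hub Hlub]].
  - exists M. intros y [T [HT ->]].
    apply Rle_trans with (RInt (fun t => M * exp (- t)) 0 T).
    + apply RInt_le; [exact HT | apply Hex | eexists; apply RInt_exp_opp |].
      intros t Ht. apply Hf. lra.
    + rewrite (is_RInt_unique _ _ _ _ (RInt_exp_opp M T)).
      assert (h := exp_pos (- T)). nra.
  - exists (RInt f 0 0), 0. split; [lra | easy].
  - exists l. split.
    + intros P [eps HP].
      assert (HT0 : exists T0, 0 <= T0 /\ l - eps < RInt f 0 T0).
      { destruct (Classical_Prop.classic (exists T0, 0 <= T0 /\ l - eps < RInt f 0 T0))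
          as [H | H]; [exact H | exfalso].
        assert (l <= l - eps).
        { apply Hlub. intros y [T [HT ->]]. apply Rnot_lt_le. intros h.
          apply H. now exists T. }
        assert (h := cond_pos eps). lra. }
      destruct HT0 as [T0 [HT0 Hl]].
      apply (Filter_prod _ _ _ (fun a => a = 0) (fun b => T0 < b)).
      * reflexivity.
      * exists T0. easy.
      * intros a b -> Hb. exists (RInt f 0 b). split.
        -- apply (RInt_correct (V := R_CompleteNormedModule)), Hex.
        -- apply HP. apply Rabs_def1; unfold minus, plus, opp; simpl.
           ++ assert (RInt f 0 b <= l) by (apply Hub; exists b; split; [lra | easy]).
              assert (h := cond_pos eps). lra.
           ++ assert (h := Hmono T0 b ltac:(lra)). lra.
    + intros T HT. apply Hub. now exists T.
Qed.

Definition kernel (mu x t : R) : R := exp (- x * cosh t) * cosh (mu * t).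

Lemma cosh_ge_1 (t : R) : 1 <= cosh t.
Proof.
  unfold cosh. assert (h := exp_pos t). assert (h' := exp_pos (- t)).
  assert (E : exp t * exp (- t) = 1) by (rewrite <- exp_plus, Rplus_opp_r; apply exp_0).
  assert (h2 := pow2_ge_0 (exp t - exp (- t))). nra.
Qed.

(** From exp t = (exp (t/2))^2 >= (1 + t/2)^2 >= t^2 / 4. *)
Lemma cosh_ge_sqr (t : R) : 0 <= t -> t ^ 2 / 8 <= cosh t.
Proof.
  intros Ht. unfold cosh. assert (h' := exp_pos (- t)).
  assert (E : exp t = exp (t / 2) * exp (t / 2)) by (rewrite <- exp_plus; f_equal; field).
  assert (h := exp_ineq1_le (t / 2)). nra.
Qed.

Lemma cosh_sinh_le_exp (mu t : R) :
  0 <= t -> cosh (mu * t) <= exp (Rabs mu * t) /\ Rabs (sinh (mu * t)) <= exp (Rabs mu * t).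
Proof.
  intros Ht.
  assert (h1 : exp (mu * t) <= exp (Rabs mu * t)).
  { apply exp_le. apply Rmult_le_compat_r; [exact Ht | apply Rle_abs]. }
  assert (h2 : exp (- (mu * t)) <= exp (Rabs mu * t)).
  { apply exp_le. rewrite Ropp_mult_distr_l.
    apply Rmult_le_compat_r; [exact Ht | rewrite <- Rabs_Ropp; apply Rle_abs]. }
  assert (h3 := exp_pos (mu * t)). assert (h4 := exp_pos (- (mu * t))).
  unfold cosh, sinh. split; [lra | apply Rabs_le; lra].
Qed.

(** By x cosh t >= x t^2 / 8 the exponent to bound is (a + 1) t - x t^2 / 8, whose maximum is 2 (a +
    1)^2 / x. *)
Lemma exp_cosh_decay (a x t : R) :
  0 < x -> 0 <= t ->
  exp (- x * cosh t) * exp (a * t) <= exp (2 * (a + 1) ^ 2 / x) * exp (- t).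
Proof.
  intros Hx Ht. rewrite <- !exp_plus. apply exp_le.
  assert (h := cosh_ge_sqr t Ht).
  assert (h2 : 2 * (a + 1) ^ 2 / x - (a + 1) * t + x * (t ^ 2 / 8)
               = (4 * (a + 1) - x * t) ^ 2 / (8 * x)) by (field; lra).
  assert (h3 : 0 <= (4 * (a + 1) - x * t) ^ 2 / (8 * x)).
  { apply Rmult_le_pos; [apply pow2_ge_0 | left; apply Rinv_0_lt_compat; lra]. }
  nra.
Qed.

Lemma kernel_pos (mu x t : R) : 0 < kernel mu x t.
Proof.
  apply Rmult_lt_0_compat; [apply exp_pos|]. assert (h := cosh_ge_1 (mu * t)). lra.
Qed.

Lemma kernel_continuous (mu x t : R) : continuous (kernel mu x) t.
Proof.
  apply (ex_derive_continuous (kernel mu x)). unfold kernel. auto_derive. easy.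
Qed.

Lemma BesselK_spec (mu x : R) :
  0 < x ->
  is_RInt_ray (kernel mu x) (BesselK mu x) /\
  forall T, 0 <= T -> RInt (kernel mu x) 0 T <= BesselK mu x.
Proof.
  intros Hx.
  destruct (is_RInt_ray_of_exp_bound (kernel mu x) (exp (2 * (Rabs mu + 1) ^ 2 / x)))
    as [l [Hl HT]].
  - apply kernel_continuous.
  - intros t Ht. split; [left; apply kernel_pos|].
    eapply Rle_trans; [|apply exp_cosh_decay; assumption].
    apply Rmult_le_compat_l; [left; apply exp_pos | now apply cosh_sinh_le_exp].
  - assert (E : BesselK mu x = l) by (apply is_RInt_gen_unique; exact Hl).
    now rewrite E.
Qed.

Lemma BesselK_pos (mu x : R) : 0 < x -> 0 < BesselK mu x.
Proof.
  intros Hx. eapply Rlt_le_trans; [|apply (proj2 (BesselK_spec mu x Hx) 1); lra].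
  apply RInt_gt_0; [lra | intros; apply kernel_pos | intros; apply kernel_continuous].
Qed.

(** Product-to-sum formula: a factor cosh t in the integrand becomes a shift of the order by one, in
    both directions. *)
Lemma kernel_cosh (mu x t : R) :
  2 * (cosh t * kernel mu x t) = kernel (mu + 1) x t + kernel (mu - 1) x t.
Proof.
  unfold kernel. set (E := exp (- x * cosh t)). clearbody E. unfold cosh.
  replace ((mu + 1) * t) with (mu * t + t) by ring.
  replace ((mu - 1) * t) with (mu * t + - t) by ring.
  rewrite !Ropp_plus_distr, Ropp_involutive, !exp_plus. field.
Qed.

Lemma kernel_sinh (mu x t : R) :
  2 * (exp (- x * cosh t) * (sinh t * sinh (mu * t)))
  = kernel (mu + 1) x t - kernel (mu - 1) x t.
Proof.
  unfold kernel. set (E := exp (- x * cosh t)). clearbody E. unfold cosh, sinh.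
  replace ((mu + 1) * t) with (mu * t + t) by ring.
  replace ((mu - 1) * t) with (mu * t + - t) by ring.
  rewrite !Ropp_plus_distr, Ropp_involutive, !exp_plus. field.
Qed.

Lemma is_RInt_ray_ext (f g : R -> R) (l : R) :
  (forall t, f t = g t) -> is_RInt_ray f l -> is_RInt_ray g l.
Proof. intros H. apply is_RInt_gen_ext. apply ray_forall. intros b _ t _. apply H. Qed.

Lemma is_RInt_ray_lin (f g : R -> R) (a b lf lg : R) :
  is_RInt_ray f lf -> is_RInt_ray g lg ->
  is_RInt_ray (fun t => a * f t + b * g t) (a * lf + b * lg).
Proof.
  intros Hf Hg.
  exact (is_RInt_gen_plus _ _ _ _ (is_RInt_gen_scal f a lf Hf) (is_RInt_gen_scal g b lg Hg)).
Qed.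

(* Integrating the derivative of [exp (- x cosh t) sinh (mu t)] over the half-line. *)
Lemma BesselK_rec (mu x : R) :
  0 < x -> x * (BesselK (mu + 1) x - BesselK (mu - 1) x) = 2 * mu * BesselK mu x.
Proof.
  intros Hx.
  set (G := fun t => exp (- x * cosh t) * sinh (mu * t)).
  assert (HG : forall t, is_derive G t
     (mu * kernel mu x t
      + 1 * (- x / 2 * kernel (mu + 1) x t + x / 2 * kernel (mu - 1) x t))).
  { intros t.
    replace (mu * kernel mu x t
      + 1 * (- x / 2 * kernel (mu + 1) x t + x / 2 * kernel (mu - 1) x t))
      with (mu * kernel mu x t - x / 2 * (kernel (mu + 1) x t - kernel (mu - 1) x t))
      by field.
    rewrite <- kernel_sinh.
    unfold G, kernel. auto_derive; [easy | field]. }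
  (* The boundary terms vanish: sinh 0 = 0 at the left end, and the decay bound used for the kernel
     applies at infinity. *)
  assert (H1 : is_RInt_ray (Derive G) (0 - 0)).
  { apply is_RInt_gen_Derive.
    - apply ray_forall. intros b _ t _. eexists. apply HG.
    - apply ray_forall. intros b _ t _.
      apply (continuous_ext (fun t => mu * kernel mu x t
        + 1 * (- x / 2 * kernel (mu + 1) x t + x / 2 * kernel (mu - 1) x t))).
      + intros u. symmetry. apply is_derive_unique, HG.
      + apply (ex_derive_continuous (fun t => mu * kernel mu x t
          + 1 * (- x / 2 * kernel (mu + 1) x t + x / 2 * kernel (mu - 1) x t))).
        unfold kernel. auto_derive. easy.
    - intros P HP. unfold filtermap, at_point.
      replace (G 0) with 0; [now apply locally_singleton|].
      unfold G. rewrite Rmult_0_r, sinh_0. ring.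
    - set (M := exp (2 * (Rabs mu + 1) ^ 2 / x)).
      assert (Hlim : is_lim (fun t => M * exp (- t)) p_infty 0).
      { replace (Finite 0) with (Rbar_mult M 0) by (simpl; f_equal; ring).
        apply is_lim_scal_l.
        apply (is_lim_comp exp Ropp p_infty 0 m_infty).
        - apply is_lim_exp_m.
        - apply (is_lim_opp (fun t => t) p_infty p_infty), is_lim_id.
        - now exists 0. }
      apply (is_lim_le_le_loc (fun t => - (M * exp (- t))) (fun t => M * exp (- t)) G p_infty 0).
      + exists 0. intros t Ht.
        assert (Hb : Rabs (G t) <= M * exp (- t)).
        { unfold G. rewrite Rabs_mult, (Rabs_pos_eq (exp _)) by (left; apply exp_pos).
          eapply Rle_trans; [|apply exp_cosh_decay; lra].
          apply Rmult_le_compat_l; [left; apply exp_pos | apply cosh_sinh_le_exp; lra]. }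
        apply Rabs_le_between in Hb. lra.
      + replace (Finite 0) with (Rbar_opp 0) by (simpl; f_equal; ring).
        now apply is_lim_opp.
      + exact Hlim. }
  apply (is_RInt_ray_ext _ (fun t => mu * kernel mu x t
      + 1 * (- x / 2 * kernel (mu + 1) x t + x / 2 * kernel (mu - 1) x t))) in H1;
    [|intros t; apply is_derive_unique, HG].
  assert (H2 := is_RInt_ray_lin _ _ mu 1 _ _ (proj1 (BesselK_spec mu x Hx))
    (is_RInt_ray_lin _ _ (- x / 2) (x / 2) _ _
       (proj1 (BesselK_spec (mu + 1) x Hx)) (proj1 (BesselK_spec (mu - 1) x Hx)))).
  apply (is_RInt_gen_unique (V := R_CompleteNormedModule)) in H1.
  apply (is_RInt_gen_unique (V := R_CompleteNormedModule)) in H2.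
  rewrite H1 in H2. lra.
Qed.

(** * Differentiation of K_nu under the integral sign *)

(** Multiplying 1 - u <= exp (- u) by exp u gives exp u - 1 <= u exp u, so the remainder, which is
    nonnegative, is at most u (exp u - 1). *)
Lemma exp_taylor_2 (u : R) : Rabs (exp u - 1 - u) <= u ^ 2 * exp (Rabs u).
Proof.
  assert (h1 := exp_ineq1_le u). assert (h2 := exp_ineq1_le (- u)).
  assert (he := exp_pos u).
  assert (E : exp u * exp (- u) = 1) by (rewrite <- exp_plus, Rplus_opp_r; apply exp_0).
  assert (h3 : exp u - 1 <= u * exp u) by nra.
  rewrite Rabs_pos_eq by lra.
  destruct (Rle_lt_dec 0 u) as [Hu | Hu].
  - rewrite (Rabs_pos_eq u) by exact Hu. nra.
  - assert (h4 : 1 <= exp (Rabs u)).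
    { rewrite <- exp_0. apply exp_le, Rabs_pos. }
    assert (h5 := pow2_ge_0 u). nra.
Qed.

(** The remainder carries a factor exp (|h| cosh t); with |h| <= x/2 it is absorbed by half of the
    decay. This leaves a majorant at x/2 whose integral does not depend on h. *)
Lemma kernel_taylor (mu x h t : R) :
  Rabs h <= x / 2 ->
  Rabs (kernel mu (x + h) t - kernel mu x t + h * (cosh t * kernel mu x t))
  <= h ^ 2 * (cosh t * (cosh t * kernel mu (x / 2) t)).
Proof.
  intros Hh. unfold kernel.
  assert (Hc := cosh_ge_1 t). assert (Hm := cosh_ge_1 (mu * t)).
  set (c := cosh t) in *. set (m := cosh (mu * t)) in *. clearbody c m.
  assert (E1 : exp (- (x + h) * c) = exp (- x * c) * exp (- h * c))
    by (rewrite <- exp_plus; f_equal; ring).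
  rewrite E1.
  replace (exp (- x * c) * exp (- h * c) * m - exp (- x * c) * m
           + h * (c * (exp (- x * c) * m)))
    with (exp (- x * c) * m * (exp (- h * c) - 1 - - h * c)) by ring.
  assert (Hp : 0 < exp (- x * c) * m) by (apply Rmult_lt_0_compat; [apply exp_pos | lra]).
  rewrite Rabs_mult, (Rabs_pos_eq (_ * m)) by lra.
  eapply Rle_trans; [apply Rmult_le_compat_l; [lra | apply exp_taylor_2]|].
  replace (exp (- x * c) * m * ((- h * c) ^ 2 * exp (Rabs (- h * c))))
    with (h ^ 2 * c ^ 2 * m * (exp (- x * c) * exp (Rabs (- h * c)))) by ring.
  replace (h ^ 2 * (c * (c * (exp (- (x / 2) * c) * m))))
    with (h ^ 2 * c ^ 2 * m * exp (- (x / 2) * c)) by ring.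
  apply Rmult_le_compat_l.
  - apply Rmult_le_pos; [|lra]. apply Rmult_le_pos; apply pow2_ge_0.
  - rewrite <- exp_plus. apply exp_le.
    rewrite Rabs_mult, Rabs_Ropp, (Rabs_pos_eq c) by lra. nra.
Qed.

Lemma is_RInt_ray_cosh_kernel (mu x : R) :
  0 < x ->
  is_RInt_ray (fun t => cosh t * kernel mu x t)
    (1 / 2 * BesselK (mu + 1) x + 1 / 2 * BesselK (mu - 1) x).
Proof.
  intros Hx.
  apply (is_RInt_ray_ext (fun t => 1 / 2 * kernel (mu + 1) x t + 1 / 2 * kernel (mu - 1) x t)).
  - intros t. assert (h := kernel_cosh mu x t). lra.
  - apply is_RInt_ray_lin; now apply BesselK_spec.
Qed.

Lemma is_derive_BesselK (mu x : R) :
  0 < x ->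
  is_derive (BesselK mu) x (- (1 / 2 * BesselK (mu + 1) x + 1 / 2 * BesselK (mu - 1) x)).
Proof.
  intros Hx.
  set (D := 1 / 2 * BesselK (mu + 1) x + 1 / 2 * BesselK (mu - 1) x).
  (* [M] is the integral of cosh^2 t times the kernel at x/2: two applications of [kernel_cosh]
     express it through values of K. *)
  set (M := 1 / 2 * (1 / 2 * BesselK (mu + 1 + 1) (x / 2) + 1 / 2 * BesselK (mu + 1 - 1) (x / 2))
          + 1 / 2 * (1 / 2 * BesselK (mu - 1 + 1) (x / 2) + 1 / 2 * BesselK (mu - 1 - 1) (x / 2))).
  assert (Hx2 : 0 < x / 2) by lra.
  assert (HM : is_RInt_ray (fun t => cosh t * (cosh t * kernel mu (x / 2) t)) M).
  { apply (is_RInt_ray_ext (fun t => 1 / 2 * (cosh t * kernel (mu + 1) (x / 2) t)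
                                    + 1 / 2 * (cosh t * kernel (mu - 1) (x / 2) t))).
    - intros t. assert (h := kernel_cosh mu (x / 2) t). nra.
    - apply is_RInt_ray_lin; now apply is_RInt_ray_cosh_kernel. }
  assert (HM0 : 0 < M).
  { unfold M. assert (h1 := BesselK_pos (mu + 1 + 1) _ Hx2).
    assert (h2 := BesselK_pos (mu + 1 - 1) _ Hx2).
    assert (h3 := BesselK_pos (mu - 1 + 1) _ Hx2).
    assert (h4 := BesselK_pos (mu - 1 - 1) _ Hx2). lra. }
  assert (Hq : forall h, Rabs h <= x / 2 ->
     Rabs (BesselK mu (x + h) - BesselK mu x + h * D) <= h ^ 2 * M).
  { intros h Hh.
    assert (Hxh : 0 < x + h) by (apply Rabs_le_between in Hh; lra).
    assert (HI := is_RInt_ray_lin _ _ 1 h _ _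
      (is_RInt_ray_lin _ _ 1 (-1) _ _ (proj1 (BesselK_spec mu (x + h) Hxh))
         (proj1 (BesselK_spec mu x Hx))) (is_RInt_ray_cosh_kernel mu x Hx)).
    assert (HJ := is_RInt_gen_scal _ (h ^ 2) _ HM).
    assert (HN := fun h1 h2 => RInt_gen_norm _ _ _ _ h1 h2 HI HJ).
    replace (BesselK mu (x + h) - BesselK mu x + h * D)
      with (1 * (1 * BesselK mu (x + h) + -1 * BesselK mu x) + h * D) by ring.
    apply HN.
    - apply ray_forall. easy.
    - apply ray_forall. intros b _ t _.
      change (Rabs (1 * (1 * kernel mu (x + h) t + -1 * kernel mu x t)
                    + h * (cosh t * kernel mu x t))
              <= h ^ 2 * (cosh t * (cosh t * kernel mu (x / 2) t))).
      eapply Rle_trans; [|now apply kernel_taylor].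
      right. f_equal. ring. }
  apply is_derive_Reals. intros eps Heps.
  (* The bound x/2 makes the Taylor estimate valid; the bound eps / M makes the remainder divided by
     |h|, at most |h| M, smaller than eps. *)
  assert (Hdel : 0 < Rmin (x / 2) (eps / M)).
  { apply Rmin_pos; [lra | now apply Rdiv_lt_0_compat]. }
  exists (mkposreal _ Hdel). simpl. intros h Hh0 Hh.
  assert (h1 : Rabs h < x / 2) by (eapply Rlt_le_trans; [exact Hh | apply Rmin_l]).
  assert (h2 : Rabs h < eps / M) by (eapply Rlt_le_trans; [exact Hh | apply Rmin_r]).
  specialize (Hq h ltac:(lra)).
  replace ((BesselK mu (x + h) - BesselK mu x) / h - - D)
    with ((BesselK mu (x + h) - BesselK mu x + h * D) / h) by (field; exact Hh0).
  unfold Rdiv at 1. rewrite Rabs_mult, Rabs_inv.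
  assert (Ha : 0 < Rabs h) by now apply Rabs_pos_lt.
  apply (Rmult_lt_reg_r (Rabs h)); [exact Ha|].
  rewrite Rmult_assoc, Rinv_l, Rmult_1_r by lra.
  eapply Rle_lt_trans; [exact Hq|].
  rewrite <- (pow2_abs h).
  apply (Rmult_lt_compat_r M) in h2; [|exact HM0].
  unfold Rdiv in h2. rewrite Rmult_assoc, Rinv_l, Rmult_1_r in h2 by lra.
  nra.
Qed.

(** * The logarithmic derivative of K_nu and the upper bound *)

Definition log_derivative_K (nu x : R) : R := x * (BesselK (nu + 1) x / BesselK nu x) - nu.

(** The derivatives of K_nu and K_{nu+1} bring in the orders nu - 1 and nu + 2; the recurrences at
    nu and nu + 1 eliminate both. *)
Lemma is_derive_log_derivative_K (nu x : R) :
  0 < x ->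
  is_derive (log_derivative_K nu) x ((log_derivative_K nu x ^ 2 - x ^ 2 - nu ^ 2) / x).
Proof.
  intros Hx.
  assert (Ha := is_derive_BesselK nu x Hx).
  assert (Hb := is_derive_BesselK (nu + 1) x Hx).
  assert (Ra := BesselK_rec nu x Hx).
  assert (Rb := BesselK_rec (nu + 1) x Hx).
  replace (nu + 1 - 1) with nu in Hb, Rb by ring.
  assert (Pa := BesselK_pos nu x Hx).
  assert (Hd := is_derive_div _ _ x _ _ Hb Ha ltac:(lra)).
  assert (Hm := is_derive_mult _ _ x _ _ (is_derive_id x) Hd Rmult_comm).
  assert (Hp := is_derive_minus _ _ x _ _ Hm (is_derive_const nu x)).
  unfold log_derivative_K at 2.
  set (a := BesselK nu x) in *. set (b := BesselK (nu + 1) x) in *.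
  set (c := BesselK (nu + 1 + 1) x) in *. set (d := BesselK (nu - 1) x) in *.
  replace (((x * (b / a) - nu) ^ 2 - x ^ 2 - nu ^ 2) / x)
    with (1 * (b / a) + x * ((- (1 / 2 * c + 1 / 2 * a) * a - b * - (1 / 2 * b + 1 / 2 * d))
                             / a ^ 2) + - 0).
  - exact Hp.
  - clearbody a b c d.
    assert (Ec : c = a + 2 * (nu + 1) * b / x).
    { apply (Rmult_eq_reg_l x); [|lra].
      replace (x * (a + 2 * (nu + 1) * b / x)) with (x * a + 2 * (nu + 1) * b)
        by (field; lra). lra. }
    assert (Ed : d = b - 2 * nu * a / x).
    { apply (Rmult_eq_reg_l x); [|lra].
      replace (x * (b - 2 * nu * a / x)) with (x * b - 2 * nu * a) by (field; lra). lra. }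
    rewrite Ec, Ed. field. lra.
Qed.

Lemma log_derivative_K_upper (nu x : R) :
  1 / 2 <= nu -> 0 < x -> log_derivative_K nu x < - riccati_bound (-1) nu x.
Proof.
  intros Hnu Hx. apply Rnot_le_lt. intros Hle.
  set (v := fun u => log_derivative_K nu u + riccati_bound (-1) nu u).
  set (dv := fun u => (log_derivative_K nu u ^ 2 - u ^ 2 - nu ^ 2) / u
                      + riccati_bound_derivative nu u (-1)).
  assert (Hd : forall u, 0 < u -> is_derive v u (dv u)).
  { intros u Hu.
    apply (is_derive_plus (log_derivative_K nu) (riccati_bound (-1) nu) u).
    - now apply is_derive_log_derivative_K.
    - apply is_derive_riccati_bound; [exact Hnu | nra]. }
  assert (Hdv : forall u, 0 < u -> 0 <= v u -> v u ^ 2 < u * dv u).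
  { intros u Hu Hv.
    assert (Hb := riccati_bound_upper nu u Hnu Hu).
    replace (u * dv u) with (log_derivative_K nu u ^ 2 - u ^ 2 - nu ^ 2
      + u * riccati_bound_derivative nu u (-1)) by (unfold dv; field; lra).
    (* With B this bound and z = v - B, one has z^2 - B^2 = v^2 - 2 v B >= v^2, because B < 0 <=
       v. *)
    assert (HB : riccati_bound (-1) nu u < 0).
    { unfold riccati_bound.
      assert (h1 := radical_pos nu u (-1) ltac:(nra)).
      assert (h2 := cos2_pos nu u Hnu). lra. }
    unfold v in *. nra. }
  assert (Hdv0 : forall u, 0 < u -> 0 <= v u -> 0 < dv u).
  { intros u Hu Hv. specialize (Hdv u Hu Hv).
    assert (h := pow2_ge_0 (v u)). nra. }
  (* At x itself [v] may vanish; it is strictly positive at every later point, so the blow-up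
     argument starts at x + 1. *)
  assert (Hpos : forall u, x + 1 <= u -> 0 < v u).
  { intros u Hu. apply (pos_of_increasing_where_nonneg v dv x u); [lra | | |].
    - intros t Ht. apply Hd. lra.
    - intros t Ht. apply Hdv0. lra.
    - unfold v. lra. }
  apply (no_global_supersolution v dv (x + 1)); [lra | | exact Hpos |].
  - intros u Hu. apply Hd. lra.
  - intros u Hu. apply Hdv; [lra | left; now apply Hpos].
Qed.

Theorem theorem6 (x nu : R) (hx : 0 < x) (hnu : 1 / 2 <= nu) :
  x * (BesselI (nu - 1) x / BesselI nu x) >
    nu - 1 / 2 * (1 + nu ^ 2 / (nu ^ 2 + x ^ 2))
    + sqrt (x ^ 2 + (nu / sqrt (nu ^ 2 + x ^ 2)
                     + sqrt (nu ^ 2 - x ^ 4 / (4 * (x ^ 2 + nu ^ 2) ^ 2))) ^ 2)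
  /\
  x * (BesselK (nu + 1) x / BesselK nu x) <
    nu + 1 / 2 * (1 + nu ^ 2 / (nu ^ 2 + x ^ 2))
    + sqrt (x ^ 2 + (- (nu / sqrt (nu ^ 2 + x ^ 2))
                     + sqrt (nu ^ 2 - x ^ 4 / (4 * (x ^ 2 + nu ^ 2) ^ 2))) ^ 2).
Proof.
  split.
  - rewrite BesselI_ratio by lra.
    assert (H := log_derivative_I_lower nu x hnu hx).
    unfold riccati_bound, radical, shifted_order, cosine, shrunk_order in H.
    rewrite !Rmult_1_l in H. lra.
  - assert (H := log_derivative_K_upper nu x hnu hx).
    unfold log_derivative_K, riccati_bound, radical, shifted_order, cosine, shrunk_order in H.
    replace (- (nu / sqrt (nu ^ 2 + x ^ 2))) with (-1 * (nu / sqrt (nu ^ 2 + x ^ 2))) by ring.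
    lra.
Qed.
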